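(* Let $\mathcal{M}^I_m$ be a timelike first kind meridian surface of hyperbolic type in $\mathbb{R}^4_1$, parametrized by $z(u,v)=f(u)\,l(v)+g(u)\,e_1$, $u\in I$, $v\in J$. Then $\mathcal{M}^I_m$ is minimal if and only if the curve $l=l(v)$ on $\mathbb{S}^2_1(1)$ has zero spherical curvature and the meridian curve $m:u\mapsto(f(u),g(u))$ is given by $$f(u)=\pm\sqrt{u^2+2au+b},\qquad g(u)=\pm\sqrt{b-a^2}\,\ln\left|u+a+\sqrt{u^2+2au+b}\right|+c,$$ where $a,b,c$ are constants with $b-a^2>0$.
   Context: $\mathbb{R}^4_1$ is the Minkowski 4-space with metric $\langle\cdot,\cdot\rangle = dx_1^2+dx_2^2+dx_3^2-dx_4^2$ and standard orthonormal frame $e_1,e_2,e_3,e_4$ ($e_4$ timelike). $\mathbb{S}^2_1(1)=\{V\in\mathrm{span}\{e_2,e_3,e_4\}:\langle V,V\rangle=1\}$. A first kind meridian surface of hyperbolic type is the surface $z(u,v)=f(u)l(v)+g(u)e_1$, where $I,J\subset\mathbb{R}$ are intervals, $f,g:I\to\mathbb{R}$ are smooth with $f>0$, and $l:J\to\mathbb{S}^2_1(1)$ is a smooth timelike curve with $\langle l',l'\rangle=-1$ (prime $=d/dv$). The meridian curve is parametrized by arc length, $\dot f^2+\dot g^2=1$ (dot $=d/du$), and $\dot g\neq0$ on $I$, i.e. $\dot f^2<1$. The spherical curvature of $l$ is $\varkappa(v)=\langle t'(v),n(v)\rangle$, where $t=l'$ and $\{l,t,n\}$ is an orthonormal frame field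 of $\mathrm{span}\{e_2,e_3,e_4\}$ with $\langle n,n\rangle=1$ (so $t'=\varkappa n+l$, $n'=\varkappa t$). The mean curvature vector field is $H=\frac12(\sigma(x,x)-\sigma(y,y))$, with $\sigma$ the second fundamental form and $\{x,y\}$ an orthonormal tangent frame with $\langle x,x\rangle=1$, $\langle y,y\rangle=-1$. The surface is minimal if $H=0$ identically. *)

(* Defs.v *)
From HB Require Import structures.
From mathcomp Require Import all_boot all_order all_algebra.
From mathcomp Require Import all_classical all_reals all_analysis.

Set Implicit Arguments.
Unset Strict Implicit.
Unset Printing Implicit Defensive.

Import Order.TTheory GRing.Theory Num.Theory.
Import numFieldNormedType.Exports.

Local Open Scope classical_set_scope.
Local Open Scope ring_scope.

Definition nondegenerate_interval (R : realType) (D : set R) : Prop :=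
  is_interval D /\ exists x y : R, [/\ D x, D y & x < y].

(* C^infinity on D in the sense of an open neighbourhood of D, so that the
   two-sided derivatives are meaningful at endpoints belonging to D; for open D
   this is the usual smoothness on D. *)
Definition smooth_on (R : realType) (V : normedModType R) (D : set R)
    (h : R -> V) : Prop :=
  exists U : set R, [/\ open U, D `<=` U &
    forall (k : nat) (x : R), U x -> derivable (derive1n k h) x 1].

Section Minkowski.
Context {R : realType}.
Implicit Types x y V w : 'rV[R]_4.

(* e1, ..., e4 are the standard row vectors, with 0-based column indices. *)
Definition e1 : 'rV[R]_4 := delta_mx 0 (inord 0).
Definition e2 : 'rV[R]_4 := delta_mx 0 (inord 1).
Definition e3 : 'rV[R]_4 := delta_mx 0 (inord 2).
Definition e4 : 'rV[R]_4 := delta_mx 0 (inord 3).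

Definition mink x y : R :=
    x 0 (inord 0) * y 0 (inord 0) + x 0 (inord 1) * y 0 (inord 1)
  + x 0 (inord 2) * y 0 (inord 2) - x 0 (inord 3) * y 0 (inord 3).

Definition span234 : set 'rV[R]_4 :=
  [set V | exists a b c : R, V = a *: e2 + b *: e3 + c *: e4].

Definition deSitter2 : set 'rV[R]_4 :=
  [set V | span234 V /\ mink V V = 1].

End Minkowski.

Section ParametrizedSurface.
Context {R : realType}.
Variable z : R -> R -> 'rV[R]_4.
Implicit Types (u v : R) (w : 'rV[R]_4) (x y : R * R).

Definition partial_u (W : R -> R -> 'rV[R]_4) u v : 'rV[R]_4 :=
  derive1 (fun s => W s v) u.
Definition partial_v (W : R -> R -> 'rV[R]_4) u v : 'rV[R]_4 :=
  derive1 (fun s => W u s) v.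

(* A pair x stands for the tangent vector x.1 z_u + x.2 z_v. *)
Definition tangent x u v : 'rV[R]_4 :=
  x.1 *: partial_u z u v + x.2 *: partial_v z u v.

(* Component of w normal to the tangent plane along the decomposition
   tangent + normal, meaningful when the Gram determinant E G - F^2 is nonzero;
   the tangential coefficients solve the Gram system by Cramer's rule. *)
Definition normal_part u v w : 'rV[R]_4 :=
  let zu := partial_u z u v in
  let zv := partial_v z u v in
  let E := mink zu zu in
  let F := mink zu zv in
  let G := mink zv zv in
  w - ((G * mink w zu - F * mink w zv) / (E * G - F ^+ 2)) *: zu
    - ((E * mink w zv - F * mink w zu) / (E * G - F ^+ 2)) *: zv.

(* Gauss formula: sigma(X, Y) is the normal part of the flat derivative D_X Y,
   where Y is extended to a tangent field with constant coefficients in the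
   coordinate frame (the result depends only on the value of Y at (u, v)). *)
Definition second_fundamental_form u v x y : 'rV[R]_4 :=
  normal_part u v
    (x.1 *: partial_u (tangent y) u v + x.2 *: partial_v (tangent y) u v).

Definition orthonormal_tangent_frame u v x y : Prop :=
  [/\ mink (tangent x u v) (tangent x u v) = 1,
      mink (tangent y u v) (tangent y u v) = -1 &
      mink (tangent x u v) (tangent y u v) = 0].

Definition is_mean_curvature_vector u v (H : 'rV[R]_4) : Prop :=
  exists x y : R * R, orthonormal_tangent_frame u v x y /\
    H = 2^-1 *: (second_fundamental_form u v x x
                 - second_fundamental_form u v y y).

Definition minimal_on (I J : set R) : Prop :=
  forall u v, I u -> J v -> is_mean_curvature_vector u v 0.

End ParametrizedSurface.

Section Meridian.
Context {R : realType}.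

Definition meridian_surface (f g : R -> R) (l : R -> 'rV[R]_4) (u v : R) :
    'rV[R]_4 :=
  f u *: l v + g u *: e1.

(* n completes l, t = l' to an orthonormal frame field of span {e2, e3, e4};
   the conditions on l and t themselves belong to [spherical_timelike_curve]. *)
Definition spherical_unit_normal (J : set R) (l n : R -> 'rV[R]_4) : Prop :=
  smooth_on J n /\
  forall v, J v ->
    [/\ span234 (n v), mink (n v) (n v) = 1, mink (n v) (l v) = 0 &
        mink (n v) (derive1 l v) = 0].

Definition spherical_timelike_curve (J : set R) (l : R -> 'rV[R]_4) : Prop :=
  smooth_on J l /\
  forall v, J v -> deSitter2 (l v) /\ mink (derive1 l v) (derive1 l v) = -1.

Definition spherical_curvature (l n : R -> 'rV[R]_4) (v : R) : R :=
  mink (derive1 (derive1 l) v) (n v).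

Definition meridian_curve (I : set R) (f g : R -> R) : Prop :=
  [/\ smooth_on I f, smooth_on I g &
      forall u, I u ->
        [/\ 0 < f u, (derive1 f u) ^+ 2 + (derive1 g u) ^+ 2 = 1 &
            derive1 g u != 0]].

End Meridian.

(* Main.v *)
Require Import Defs.
From HB Require Import structures.
From mathcomp Require Import all_boot all_order all_algebra.
From mathcomp Require Import all_classical all_reals all_analysis.
From mathcomp Require Import ring lra.

Set Implicit Arguments.
Unset Strict Implicit.
Unset Printing Implicit Defensive.

Import Order.TTheory GRing.Theory Num.Theory.
Import numFieldNormedType.Exports.
Local Open Scope classical_set_scope.
Local Open Scope ring_scope.

(** Write [z_u = f' l + g' e1] and [z_v = f l'].  Since the meridian has unit
    speed and [l] is a unit speed timelike curve on the de Sitter sphere, the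
    Gram matrix of [(z_u, z_v)] is diagonal with entries [1] and [- f^2], so
    the mean curvature vector is half of the normal part of
    [z_uu - z_vv / f^2].  The Frenet equation [l'' = l + k n]
    ([spherical_frame]) turns this into
      [H = 1/2 ((f'' - (1 - f'^2) / f) l + (g'' + f' g' / f) e1 - (k / f) n)]
    ([meridian_mean_curvature]).  The vectors [l], [e1], [n] are orthonormal,
    hence [H = 0] amounts to [k = 0] together with [f f'' + f'^2 = 1] and
    [f g'' + f' g' = 0]; differentiating [f'^2 + g'^2 = 1] shows that the last
    equation follows from the one before because [g'] does not vanish
    ([meridian_angular_momentum], [meridian_minimalP]).

    The equation [f f'' + f'^2 = 1] says [(f f')' = 1], which integrates to
    [f f' = u + a] and then to [f^2 = u^2 + 2 a u + b]
    ([meridian_ode_square]).  Next, [(f g')' = 0], so [f g'] is a constant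
    [kappa], and [kappa^2 = f^2 (1 - f'^2) = b - a^2], which is positive.
    Therefore [g' = kappa / sqrt (u^2 + 2 a u + b)], and a primitive of
    [1 / sqrt (u^2 + 2 a u + b)] is the logarithm of the statement
    ([is_derive_ln_add_sqrt]).  Conversely the formula for [f] alone gives back
    the equation for [f].

    The parameter intervals may contain their endpoints, where identities known
    only on the interval have to be differentiated.  This is legitimate because
    the two functions involved are differentiable across the endpoint and a
    two-sided derivative is determined by one-sided values
    ([derive_unique_on_interval]). *)

(** * Derivatives of functions known on an interval *)

(** A point of a nondegenerate interval is approached from inside the interval,
    so the difference quotients of [h - k] vanish along such an approach. *)
Lemma derive_unique_on_interval (R : realType) (D : set R) (h k : R -> R)
    (x dh dk : R) :
  nondegenerate_interval D -> D x -> (forall y, D y -> h y = k y) ->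
  is_derive x 1 h dh -> is_derive x 1 k dk -> dh = dk.
Proof.
move=> [Dint [p [q [Dp Dq pq]]]] Dx hk hx kx.
have [y Dy yx] : exists2 y, D y & y - x != 0.
  have [px|px] := eqVneq p x; last by exists p; rewrite // subr_eq0.
  by exists q; rewrite // -px subr_eq0 gt_eqF.
have [+ dE] : is_derive x 1 (h - k) (dh - dk) by exact: is_deriveB.
apply: contraPP => /eqP; rewrite -subr_eq0 -normr_gt0 => e0 cvd.
have : (fun t => t^-1 *: (((h - k) \o shift x) (t *: 1) - (h - k) x)) @ 0^'
  --> dh - dk by rewrite -dE.
move/cvgrPdist_lt => /(_ _ e0) [/= r r0 H].
have yx0 : 0 < `|y - x| by rewrite normr_gt0.
(* Both bounds on [m] matter: [m <= 1] keeps the test point between [x] and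
   [y], and the second one puts it in the [r]-neighbourhood of [x]. *)
pose m := Num.min 1 (r / 2 / `|y - x|).
have m0 : 0 < m by rewrite lt_min ltr01 !divr_gt0.
have m1 : m <= 1 by rewrite ge_min lexx.
have mr : m * `|y - x| < r.
  rewrite -ltr_pdivlMr// (@le_lt_trans _ _ (r / 2 / `|y - x|))//.
    by rewrite ge_min lexx orbT.
  by rewrite ltr_pM2r ?invr_gt0//; lra.
have myx0 : m * (y - x) != 0 by rewrite mulf_neq0// gt_eqF.
have := H (m * (y - x)); rewrite /ball_ /= sub0r normrN normrM gtr0_norm//.
move=> /(_ mr myx0).
have Dm : D (m * (y - x) + x).
  have [xy|/ltW yx'] := leP x y.
    by apply: (Dint _ _ Dx Dy); nra.
  by apply: (Dint _ _ Dy Dx); nra.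
rewrite /GRing.scale /= mulr1 [X in _ * (X - _)]/= !fctE (hk _ Dm) (hk _ Dx).
by rewrite !subrr mulr0 subr0 ltxx.
Qed.

(** This follows from the mean value theorem; unlike its classical form, it allows
    intervals of any shape, whose points may be endpoints. *)
Lemma is_derive0_cst_on (R : realType) (D : set R) (h : R -> R) :
  is_interval D -> (forall x, D x -> is_derive x 1 h 0) ->
  forall x y, D x -> D y -> h x = h y.
Proof.
move=> Dint dh x y.
wlog xy : x y / x <= y.
  by move=> H Dx Dy; have [/H->//|/ltW/H->] := leP x y.
move=> Dx Dy.
have DD z : z \in `[x, y]%R -> D z.
  by rewrite in_itv /= => /(Dint _ _ Dx Dy).
have [z zxy||c _ ] := @MVT_segment R h (cst 0) x y xy.
- by apply: dh; apply: DD; exact: subset_itv_oo_cc zxy.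
- by apply: derivable_within_continuous => z /DD /dh[].
- by rewrite mul0r => /eqP; rewrite subr_eq0 eq_sym => /eqP.
Qed.

(** What second order computations use of smoothness: first derivatives near the
    point, which are needed to differentiate expressions containing them, and
    second derivatives at the point. *)
Lemma smooth_onP (R : realType) (V : normedModType R) (D : set R)
    (h : R -> V) (x : R) : smooth_on D h -> D x ->
  [/\ (\forall s \near x, is_derive (s : R) 1 h (derive1 h s)),
     is_derive x 1 h (derive1 h x) &
     is_derive x 1 (derive1 h) (derive1 (derive1 h) x)].
Proof.
move=> [U [Uo DU hU]] /DU Ux.
have dk k (s : R) : U s -> is_derive s 1 (derive1n k h) (derive1n k.+1 h s).
  by move=> Us; rewrite /= derive1E; apply/derivableP/hU.
split; [|exact: (dk 0)|exact: (dk 1)].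
by near=> s; apply: (dk 0%N); near: s; exact: open_nbhs_nbhs.
Unshelve. all: by end_near. Qed.

(** * Derivatives of vector valued functions *)

Lemma is_derive_mxP (R : realType) m n (M : R -> 'M[R]_(m, n)) (x : R)
    (dM : 'M[R]_(m, n)) :
  is_derive x 1 M dM <->
  forall i j, is_derive x 1 (fun s => M s i j) (dM i j).
Proof.
split=> [[dx dE] i j|dij].
  by split; [exact: (derivable_mxP _ _ _).1|rewrite -dE derive_mx// mxE].
have dx : derivable M x 1 by apply/derivable_mxP => i j; case: (dij i j).
apply: DeriveDef => //; rewrite derive_mx//; apply/matrixP => i j.
by rewrite mxE; case: (dij i j).
Qed.

Lemma is_derive_scalel (R : realType) (f : R -> R) (w : 'rV[R]_4) (x df : R) :
  is_derive x 1 f df -> is_derive x 1 (fun s => f s *: w) (df *: w).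
Proof.
move=> fx; apply/is_derive_mxP => i j; rewrite mxE.
rewrite (_ : (fun s => _) = f * cst (w i j)); last first.
  by apply/funext => s; rewrite mxE.
by apply: is_derive_eq; rewrite scaler0 add0r /GRing.scale /= mulrC.
Qed.

Lemma is_derive_mink (R : realType) (F G : R -> 'rV[R]_4) (x : R)
    (dF dG : 'rV[R]_4) :
  is_derive x 1 F dF -> is_derive x 1 G dG ->
  is_derive x 1 (fun s => mink (F s) (G s)) (mink dF (G x) + mink (F x) dG).
Proof.
move=> /is_derive_mxP Fx /is_derive_mxP Gx.
pose p i s := F s 0 i * G s 0 i.
have px i : is_derive x 1 (p i) (F x 0 i * dG 0 i + G x 0 i * dF 0 i).
  exact: is_deriveM.
rewrite (_ : (fun s => _) =
  p (inord 0) + p (inord 1) + p (inord 2) - p (inord 3)) //.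
by apply: is_derive_eq; rewrite /mink; ring.
Qed.

(** * The Minkowski product *)

Lemma minkC (R : realType) (x y : 'rV[R]_4) : mink x y = mink y x.
Proof. by rewrite /mink; ring. Qed.

Lemma minkDl (R : realType) (x y w : 'rV[R]_4) :
  mink (x + y) w = mink x w + mink y w.
Proof. by rewrite /mink !mxE; ring. Qed.

Lemma minkZl (R : realType) (a : R) (x w : 'rV[R]_4) :
  mink (a *: x) w = a * mink x w.
Proof. by rewrite /mink !mxE; ring. Qed.

Lemma minkBl (R : realType) (x y w : 'rV[R]_4) :
  mink (x - y) w = mink x w - mink y w.
Proof. by rewrite /mink !mxE; ring. Qed.

Lemma minkDr (R : realType) (x y w : 'rV[R]_4) :
  mink w (x + y) = mink w x + mink w y.
Proof. by rewrite /mink !mxE; ring. Qed.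

Lemma minkZr (R : realType) (a : R) (x w : 'rV[R]_4) :
  mink w (a *: x) = a * mink w x.
Proof. by rewrite /mink !mxE; ring. Qed.

Lemma mink0r (R : realType) (w : 'rV[R]_4) : mink w 0 = 0.
Proof. by rewrite /mink !mxE; ring. Qed.

(** [minkBl] comes first: a difference is also a sum, of which [minkDl] would
    leave an opposite. *)
Definition mink_linE := (minkBl, minkDl, minkZl, minkDr, minkZr).

Lemma e1E (R : realType) i : e1 0 i = (i == inord 0)%:R :> R.
Proof. by rewrite /e1 mxE eqxx. Qed.

Lemma inord4_eq (i j : nat) : (i < 4)%N -> (j < 4)%N ->
  (inord i == inord j :> 'I_4) = (i == j).
Proof. by move=> i4 j4; rewrite -val_eqE /= !inordK. Qed.

Lemma mink_e1 (R : realType) (x : 'rV[R]_4) : mink x e1 = x 0 (inord 0).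
Proof. by rewrite /mink !e1E !inord4_eq //=; ring. Qed.

Lemma mink_e1e1 (R : realType) : mink e1 e1 = 1 :> R.
Proof. by rewrite mink_e1 e1E eqxx. Qed.

Lemma mink_span234 (R : realType) (x : 'rV[R]_4) : span234 x -> mink x e1 = 0.
Proof.
move=> [a [b [c ->]]]; rewrite mink_e1 !mxE !inord4_eq //=; ring.
Qed.

Lemma mink_mx (R : realType) (x y : 'rV[R]_4) :
  mink x y =
  (x *m diag_mx (\row_j (if j == inord 3 then -1 else 1)) *m y^T) 0 0.
Proof.
have E0 : ord0 = inord 0 :> 'I_4 by apply/val_inj; rewrite /= inordK.
have E1 : lift ord0 ord0 = inord 1 :> 'I_4 by apply/val_inj; rewrite /= inordK.
have E2 : lift ord0 (lift ord0 ord0) = inord 2 :> 'I_4.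
  by apply/val_inj; rewrite /= inordK.
have E3 : lift ord0 (lift ord0 (lift ord0 ord0)) = inord 3 :> 'I_4.
  by apply/val_inj; rewrite /= inordK.
rewrite mul_mx_diag mxE !big_ord_recl big_ord0 !mxE E1 E2 E3 E0.
by rewrite !inord4_eq //= /mink; ring.
Qed.

(** With [M] the matrix of rows [b i] and [eta] the matrix of the Minkowski
    product, [M eta M^T = diag d] is invertible; hence so is [eta M^T], and [w]
    is recovered from the row [w eta M^T] of its products with the frame. *)
Lemma mink_frame_eq0 (R : realType) (b : 'I_4 -> 'rV[R]_4) (d : 'I_4 -> R)
    (w : 'rV[R]_4) :
  (forall i j, mink (b i) (b j) = d i *+ (i == j)) -> (forall i, d i != 0) ->
  (forall i, mink w (b i) = 0) -> w = 0.
Proof.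
move=> bd d0 wb.
pose eta : 'M[R]_4 := diag_mx (\row_j (if j == inord 3 then -1 else 1)).
pose M := \matrix_i b i.
have minkE (x y : 'rV[R]_4) : mink x y = (x *m eta *m y^T) 0 0.
  exact: mink_mx.
have MM : M *m eta *m M^T = diag_mx (\row_i d i).
  apply/matrixP => i j; rewrite [RHS]mxE [X in X *+ _]mxE -bd minkE.
  have -> : b i = row i M by rewrite rowK.
  have -> : b j = row j M by rewrite rowK.
  by rewrite -row_mul !mxE; apply: eq_bigr => k _; rewrite !mxE.
have U : eta *m M^T \in unitmx.
  have : M *m eta *m M^T \in unitmx.
    rewrite MM unitmxE det_diag unitfE; apply/prodf_neq0 => i _.
    by rewrite mxE.
  by rewrite -mulmxA unitmx_mul => /andP[].
apply: (can_inj (mulmxK U)); rewrite mul0mx; apply/rowP => i.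
rewrite [RHS]mxE -(wb i) minkE.
have -> : b i = row i M by rewrite rowK.
by rewrite mulmxA !mxE; apply: eq_bigr => k _; rewrite !mxE.
Qed.

(** For a spherical curve [l] with velocity [t] and normal [n], the vectors [e1],
    [l], [t], [n] form an orthonormal frame, so a vector orthogonal to all of
    them is zero. *)
Lemma adapted_frame_eq0 (R : realType) (l t n w : 'rV[R]_4) :
  mink l e1 = 0 -> mink t e1 = 0 -> mink n e1 = 0 ->
  mink l l = 1 -> mink t t = -1 -> mink n n = 1 ->
  mink l t = 0 -> mink n l = 0 -> mink n t = 0 ->
  mink w e1 = 0 -> mink w l = 0 -> mink w t = 0 -> mink w n = 0 -> w = 0.
Proof.
move=> le te ne ll tt nn lt nl nt we wl wt wn.
pose b (i : 'I_4) := nth 0 [:: e1; l; t; n] i.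
pose d (i : 'I_4) : R := nth 0 [:: 1; 1; -1; 1] i.
apply: (@mink_frame_eq0 _ b d).
- move=> [[|[|[|[|//]]]] i] [[|[|[|[|//]]]] j];
    rewrite /b /d -val_eqE /= ?mulr1n ?mulr0n ?mink_e1e1 //;
    by [| rewrite minkC].
- by move=> [[|[|[|[|//]]]] i]; rewrite /d /= ?oppr_eq0 ?oner_eq0.
- by move=> [[|[|[|[|//]]]] i].
Qed.

(** * Second fundamental form of a meridian surface *)

Lemma normal_part_lin (R : realType) (z : R -> R -> 'rV[R]_4) u v (a : R)
    (x y : 'rV[R]_4) :
  normal_part z u v (a *: x + y) =
  a *: normal_part z u v x + normal_part z u v y.
Proof.
rewrite /normal_part !mink_linE /=.
move: (partial_u z u v) (partial_v z u v) => p q.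
move: (mink p p) (mink p q) (mink q q) (mink x p) (mink x q) (mink y p)
  (mink y q) => E F G xp xq yp yq.
move: (E * G - F ^+ 2)^-1 => D.
by apply/rowP => k; rewrite !mxE; ring.
Qed.

Lemma derive1_val (R : realType) (V : normedModType R) (h : R -> V) (x : R)
    (dh : V) : is_derive x 1 h dh -> derive1 h x = dh.
Proof. by move=> hx; rewrite derive1E derive_val. Qed.

Lemma meridian_partial_u (R : realType) (f g : R -> R) (l : R -> 'rV[R]_4)
    (u v df dg : R) :
  is_derive u 1 f df -> is_derive u 1 g dg ->
  partial_u (meridian_surface f g l) u v = df *: l v + dg *: e1.
Proof.
move=> fu gu; apply: derive1_val.
have fl := is_derive_scalel (l v) fu.
have ge := is_derive_scalel e1 gu.
exact: (is_deriveD fl ge).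
Qed.

Lemma meridian_partial_v (R : realType) (f g : R -> R) (l : R -> 'rV[R]_4)
    (u v : R) (dl : 'rV[R]_4) :
  is_derive v 1 l dl ->
  partial_v (meridian_surface f g l) u v = f u *: dl.
Proof.
move=> lv; apply: derive1_val; rewrite -[X in is_derive _ _ _ X]addr0.
exact: (is_deriveD (is_deriveZ (f u) lv) (is_derive_cst (g u *: e1) v 1)).
Qed.

Section MeridianSecondOrder.
Context (R : realType) (I J : set R) (f g : R -> R) (l : R -> 'rV[R]_4).
Context (fI : smooth_on I f) (gI : smooth_on I g) (lJ : smooth_on J l).
Context (u v : R) (Iu : I u) (Jv : J v).

Let z := meridian_surface f g l.

Lemma meridian_tangent_u (y : R * R) :
  partial_u (tangent z y) u v =
  y.1 *: (derive1 (derive1 f) u *: l v + derive1 (derive1 g) u *: e1)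
  + y.2 *: (derive1 f u *: derive1 l v).
Proof.
have [f_near f0 f1] := smooth_onP fI Iu.
have [g_near g0 g1] := smooth_onP gI Iu.
have [_ l0 _] := smooth_onP lJ Jv.
apply: derive1_val.
pose W s := y.1 *: (derive1 f s *: l v + derive1 g s *: e1)
  + y.2 *: (f s *: derive1 l v).
apply: (@near_eq_is_derive _ _ _ W).
  near=> s; rewrite /tangent (meridian_partial_v _ _ _ l0).
  have fs : is_derive s 1 f (derive1 f s) by near: s.
  have gs : is_derive s 1 g (derive1 g s) by near: s.
  by rewrite (meridian_partial_u _ _ fs gs).
have fl := is_derive_scalel (l v) f1.
have ge := is_derive_scalel e1 g1.
have fdl := is_derive_scalel (derive1 l v) f0.
exact: (is_deriveD (is_deriveZ y.1 (is_deriveD fl ge)) (is_deriveZ y.2 fdl)).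
Unshelve. all: by end_near. Qed.

Lemma meridian_tangent_v (y : R * R) :
  partial_v (tangent z y) u v =
  y.1 *: (derive1 f u *: derive1 l v) + y.2 *: (f u *: derive1 (derive1 l) v).
Proof.
have [_ f0 f1] := smooth_onP fI Iu.
have [_ g0 g1] := smooth_onP gI Iu.
have [l_near l0 l1] := smooth_onP lJ Jv.
apply: derive1_val.
pose W s := y.1 *: (derive1 f u *: l s + derive1 g u *: e1)
  + y.2 *: (f u *: derive1 l s).
apply: (@near_eq_is_derive _ _ _ W).
  near=> s; rewrite /tangent (meridian_partial_u _ _ f0 g0).
  have ls : is_derive s 1 l (derive1 l s) by near: s.
  by rewrite (meridian_partial_v _ _ _ ls).
have fl := is_deriveZ (derive1 f u) l0.
have ge := is_derive_cst (derive1 g u *: e1) v (1 : R).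
have := is_deriveD (is_deriveZ y.1 (is_deriveD fl ge))
  (is_deriveZ y.2 (is_deriveZ (f u) l1)).
by rewrite addr0.
Unshelve. all: by end_near. Qed.

(** Bilinearity of the second fundamental form, with its three values on the
    coordinate frame [(z_u, z_v)] written as normal parts of [z_uu], [z_uv] and
    [z_vv]. *)
Lemma meridian_second_fundamental_form (x y : R * R) :
  second_fundamental_form z u v x y =
  (x.1 * y.1) *: normal_part z u v
    (derive1 (derive1 f) u *: l v + derive1 (derive1 g) u *: e1)
  + (x.1 * y.2 + x.2 * y.1) *:
      normal_part z u v (derive1 f u *: derive1 l v)
  + (x.2 * y.2) *: normal_part z u v (f u *: derive1 (derive1 l) v).
Proof.
rewrite /second_fundamental_form meridian_tangent_u meridian_tangent_v.
set zuu := _ + _ *: e1; set zuv := _ *: derive1 l v.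
set zvv := f u *: _; move: zuu zuv zvv => zuu zuv zvv.
have -> : x.1 *: (y.1 *: zuu + y.2 *: zuv) + x.2 *: (y.1 *: zuv + y.2 *: zvv)
  = (x.1 * y.1) *: zuu + ((x.1 * y.2 + x.2 * y.1) *: zuv
    + ((x.2 * y.2) *: zvv + 0)).
  by apply/rowP => k; rewrite !mxE; ring.
have n0 : normal_part z u v 0 = 0.
  have := normal_part_lin z u v 1 0 0; rewrite !scale1r !addr0.
  by move=> /eqP; rewrite -subr_eq subrr eq_sym => /eqP.
by rewrite !normal_part_lin n0 addr0 addrA.
Qed.

End MeridianSecondOrder.

(** * Frenet equation of a spherical timelike curve *)

Section SphericalFrame.
Context (R : realType) (J : set R) (l n : R -> 'rV[R]_4).
Context (hJ : nondegenerate_interval J) (hl : spherical_timelike_curve J l)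
  (hn : spherical_unit_normal J l n).

Lemma mink_derive_cst (F G : R -> 'rV[R]_4) (v c : R) (dF dG : 'rV[R]_4) :
  J v -> is_derive v 1 F dF -> is_derive v 1 G dG ->
  (forall s, J s -> mink (F s) (G s) = c) ->
  mink dF (G v) + mink (F v) dG = 0.
Proof.
move=> Jv Fv Gv FG.
exact: (derive_unique_on_interval hJ Jv FG (is_derive_mink Fv Gv)
  (is_derive_cst c v 1)).
Qed.

(** Differentiating the constant products [(l, e1)], [(l, l)], [(l', e1)],
    [(l', l')] and [(l, l')] gives the products of [l'] and [l''] with [e1],
    [l] and [l'].  Then [l'' - l - k n] is orthogonal to the whole adapted
    frame. *)
Lemma spherical_frame v : J v ->
  [/\ mink (l v) e1 = 0, mink (derive1 l v) e1 = 0,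
      mink (l v) (derive1 l v) = 0 &
  derive1 (derive1 l) v = l v + spherical_curvature l n v *: n v].
Proof.
have [lsm lD] := hl.
have le s : J s -> mink (l s) e1 = 0.
  by move=> /lD[[/mink_span234]].
have ll s : J s -> mink (l s) (l s) = 1 by move=> /lD[[]].
have tt s : J s -> mink (derive1 l s) (derive1 l s) = -1 by move=> /lD[].
have te s : J s -> mink (derive1 l s) e1 = 0.
  move=> Js; have [_ l0 _] := smooth_onP lsm Js.
  have := mink_derive_cst Js l0 (is_derive_cst e1 s 1) le.
  by rewrite mink0r addr0.
have lt s : J s -> mink (l s) (derive1 l s) = 0.
  move=> Js; have [_ l0 _] := smooth_onP lsm Js.
  have := mink_derive_cst Js l0 l0 ll.
  by rewrite [mink (derive1 l s) _]minkC; lra.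
move=> Jv; have [_ l0 l1] := smooth_onP lsm Jv.
split; [exact: le|exact: te|exact: lt|].
have [ns nn nl nt] := hn.2 v Jv.
have ne := mink_span234 ns.
have ae : mink (derive1 (derive1 l) v) e1 = 0.
  have := mink_derive_cst Jv l1 (is_derive_cst e1 v 1) te.
  by rewrite mink0r addr0.
have at_ : mink (derive1 (derive1 l) v) (derive1 l v) = 0.
  have := mink_derive_cst Jv l1 l1 tt.
  by rewrite [X in _ + X]minkC; lra.
have al : mink (derive1 (derive1 l) v) (l v) = 1.
  have := mink_derive_cst Jv l0 l1 lt.
  by rewrite tt// [X in _ + X]minkC; lra.
apply/eqP; rewrite -subr_eq0; apply/eqP.
apply: (@adapted_frame_eq0 _ (l v) (derive1 l v) (n v)) => //;
  rewrite ?le ?te ?ll ?tt ?lt ?ne ?nn ?nl ?nt //.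
- by rewrite !mink_linE ae le// ne; ring.
- by rewrite !mink_linE al ll// nl; ring.
- by rewrite !mink_linE at_ lt// nt; ring.
- by rewrite !mink_linE nn [mink (l v) _]minkC nl /spherical_curvature; ring.
Qed.

End SphericalFrame.

(** * Mean curvature vector *)

(** If the rows of a 2 x 2 matrix are orthonormal for the form [diag (1, -1)],
    so are its columns; this is [A eta A^T = eta -> A^T eta A = eta] in
    coordinates. *)
Lemma lorentz_orthogonal (R : realType) (p q r s : R) :
  p ^+ 2 - q ^+ 2 = 1 -> r ^+ 2 - s ^+ 2 = -1 -> p * r = q * s ->
  [/\ p ^+ 2 - r ^+ 2 = 1, p * q = r * s & q ^+ 2 - s ^+ 2 = -1].
Proof.
move=> pq rs prqs.
have ps : p ^+ 2 = s ^+ 2.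
  have : p ^+ 2 * r ^+ 2 = q ^+ 2 * s ^+ 2 by rewrite -!exprMn prqs.
  have -> : p ^+ 2 = 1 + q ^+ 2 by lra.
  have -> : r ^+ 2 = s ^+ 2 - 1 by lra.
  by lra.
have p0 : p != 0.
  by apply/eqP => p0; have := sqr_ge0 q; move: pq; rewrite p0; nra.
split; [lra| |lra].
apply: (mulfI p0); rewrite mulrCA [p * (r * s)]mulrA prqs.
by rewrite -mulrA -expr2 -ps; ring.
Qed.

(** The setting is that of orthogonal coordinates in which [z_u] is a spacelike
    unit vector [p] and [z_v] is the multiple by [a] of a timelike unit vector
    [q]. *)
Section OrthogonalCoordinates.
Context (R : realType) (z : R -> R -> 'rV[R]_4) (u v a : R) (p q : 'rV[R]_4).
Context (zu : partial_u z u v = p) (zv : partial_v z u v = a *: q).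
Context (a0 : a != 0).
Context (pp : mink p p = 1) (pq : mink p q = 0) (qq : mink q q = -1).

Lemma normal_part_orthogonal (w : 'rV[R]_4) :
  normal_part z u v w = w - mink w p *: p + mink w q *: q.
Proof.
rewrite /normal_part zu zv !minkZl !minkZr pp pq qq.
move: (mink w p) (mink w q) => wp wq.
rewrite mulr0 expr0n /= !mul0r !subr0 scalerA !mul1r.
have -> : a * (a * -1) * wp / (a * (a * -1)) = wp by field.
have -> : a * wq / (a * (a * -1)) * a = - wq by field.
by rewrite scaleNr opprK.
Qed.

Lemma orthonormal_tangent_frameP (x y : R * R) :
  orthonormal_tangent_frame z u v x y <->
  [/\ x.1 ^+ 2 - (a * x.2) ^+ 2 = 1, y.1 ^+ 2 - (a * y.2) ^+ 2 = -1 &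
      x.1 * y.1 = (a * x.2) * (a * y.2)].
Proof.
have ip (b c : R * R) : mink (tangent z b u v) (tangent z c u v) =
    b.1 * c.1 - (a * b.2) * (a * c.2).
  rewrite /tangent zu zv !scalerA !minkDl !minkDr !minkZl !minkZr.
  by rewrite [mink q p]minkC pp pq qq; ring.
rewrite /orthonormal_tangent_frame !ip !expr2.
split=> -[-> -> xy]; split=> //; first by apply/eqP; rewrite -subr_eq0 xy.
by rewrite xy subrr.
Qed.

(** The trace of the second fundamental form does not depend on the orthonormal
    frame: the coordinates of any such frame in [(p, q)] form a Lorentz
    matrix, so [lorentz_orthogonal] evaluates the quadratic expressions that
    multiply [suu], [suv] and [svv]. *)
Lemma is_mean_curvature_vectorP (suu suv svv H : 'rV[R]_4) :
  (forall x y, second_fundamental_form z u v x y =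
     (x.1 * y.1) *: suu + (x.1 * y.2 + x.2 * y.1) *: suv
     + (x.2 * y.2) *: svv) ->
  is_mean_curvature_vector z u v H <->
  H = 2^-1 *: (suu - (a ^+ 2)^-1 *: svv).
Proof.
move=> sE.
have traceE x y : orthonormal_tangent_frame z u v x y ->
    second_fundamental_form z u v x x - second_fundamental_form z u v y y =
    suu - (a ^+ 2)^-1 *: svv.
  move=> /orthonormal_tangent_frameP[xx yy xy].
  have [c11 c12 c22] := lorentz_orthogonal xx yy xy.
  have d12 : x.1 * x.2 = y.1 * y.2.
    by apply: (mulfI a0); rewrite mulrCA c12; ring.
  have d22 : x.2 * x.2 = y.2 * y.2 - (a ^+ 2)^-1.
    have -> : (a ^+ 2)^-1 = - (a ^+ 2)^-1 * ((a * x.2) ^+ 2 - (a * y.2) ^+ 2).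
      by rewrite c22; ring.
    by field.
  have d11 : x.1 * x.1 = 1 + y.1 * y.1 by rewrite -c11; ring.
  rewrite !sE d11 d22 [x.2 * x.1]mulrC [y.2 * y.1]mulrC d12.
  move: (y.1 * y.1) (y.1 * y.2) (y.2 * y.2) ((a ^+ 2)^-1) => r11 r12 r22 b.
  by apply/rowP => k; rewrite !mxE; ring.
split=> [[x [y [xy ->]]]|->]; first by rewrite (traceE _ _ xy).
have xy : orthonormal_tangent_frame z u v (1, 0) (0, a^-1).
  by apply/orthonormal_tangent_frameP; split => /=; field.
by exists (1, 0), (0, a^-1); rewrite (traceE _ _ xy).
Qed.

End OrthogonalCoordinates.

Lemma arc_length_derive (R : realType) (I : set R) (f g : R -> R) (u : R) :
  nondegenerate_interval I -> meridian_curve I f g -> I u ->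
  derive1 f u * derive1 (derive1 f) u + derive1 g u * derive1 (derive1 g) u = 0.
Proof.
move=> hI [fI gI fg] Iu.
have [_ _ df] := smooth_onP fI Iu; have [_ _ dg] := smooth_onP gI Iu.
have arc s : I s -> (derive1 f ^+ 2 + derive1 g ^+ 2) s = cst 1 s.
  by move=> /fg[].
have := derive_unique_on_interval hI Iu arc
  (is_deriveD (is_deriveX 2 df) (is_deriveX 2 dg)) (is_derive_cst (1 : R) u 1).
rewrite /GRing.scale /=.
move: (derive1 f u) (derive1 g u) (derive1 (derive1 f) u)
  (derive1 (derive1 g) u) => f1 g1 f2 g2 e.
by apply: (mulfI (_ : 2 != 0 :> R)); rewrite ?pnatr_eq0// mulr0 -[RHS]e; ring.
Qed.

(** Here [z_uu = f'' l + g'' e1] is already normal, because the meridian has unit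
    speed, whereas [z_vv = f (l + k n)] has the tangential part [f f' z_u]. *)
Lemma meridian_mean_curvature (R : realType) (I J : set R) (f g : R -> R)
    (l n : R -> 'rV[R]_4) (u v : R) (H : 'rV[R]_4) :
  nondegenerate_interval I -> nondegenerate_interval J ->
  meridian_curve I f g -> spherical_timelike_curve J l ->
  spherical_unit_normal J l n -> I u -> J v ->
  is_mean_curvature_vector (meridian_surface f g l) u v H <->
  H = 2^-1 *:
   ((derive1 (derive1 f) u - (1 - (derive1 f u) ^+ 2) / f u) *: l v
    + (derive1 (derive1 g) u + derive1 f u * derive1 g u / f u) *: e1
    - (spherical_curvature l n v / f u) *: n v).
Proof.
move=> hI hJ hm hl hn Iu Jv.
have [fI gI /(_ u Iu)[f0 arc _]] := hm.
have [_ df _] := smooth_onP fI Iu; have [_ dg _] := smooth_onP gI Iu.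
have [_ dl _] := smooth_onP hl.1 Jv.
have fn0 : f u != 0 by rewrite gt_eqF.
have [le te lt l2] := spherical_frame hJ hl hn Jv.
have [[_ ll] tt] := hl.2 v Jv.
have [ns nn nl nt] := hn.2 v Jv.
have ne := mink_span234 ns.
have et : mink e1 (derive1 l v) = 0 by rewrite minkC.
have el : mink e1 (l v) = 0 by rewrite minkC.
have arc' := arc_length_derive hI hm Iu.
have zu := meridian_partial_u l v df dg.
have zv := meridian_partial_v f g u dl.
have sE := meridian_second_fundamental_form fI gI hl.1 Iu Jv.
rewrite l2 in sE; clear l2 df dg dl.
move: (meridian_surface f g l) zu zv sE => z zu zv sE.
move: (spherical_curvature l n v) (derive1 l v) (derive1 (derive1 f) u)
  (derive1 (derive1 g) u) (derive1 f u) (derive1 g u)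
  te lt tt nt et arc arc' zu zv sE => k t f2 g2 f1 g1 te lt tt nt et arc arc'.
move: (f u) (l v) (n v) (@e1 R) (@mink_e1e1 R) le ll ns nn nl ne el te lt nt et
  fn0 => a L N e ee le ll ns nn nl ne el te lt nt et a0 zu zv sE.
have pp : mink (f1 *: L + g1 *: e) (f1 *: L + g1 *: e) = 1.
  by rewrite !mink_linE ee ll le el -[RHS]arc; ring.
have pq : mink (f1 *: L + g1 *: e) t = 0 by rewrite !mink_linE lt et; ring.
have normalE := normal_part_orthogonal zu zv a0 pp pq tt.
rewrite (is_mean_curvature_vectorP zu zv a0 pp pq tt H sE).
suff -> : normal_part z u v (f2 *: L + g2 *: e)
    - (a ^+ 2)^-1 *: normal_part z u v (a *: (L + k *: N)) =
    (f2 - (1 - f1 ^+ 2) / a) *: L + (g2 + f1 * g1 / a) *: e - (k / a) *: N.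
  by [].
rewrite !normalE.
have -> : mink (f2 *: L + g2 *: e) (f1 *: L + g1 *: e) = 0.
  by rewrite !mink_linE ee ll le el -[RHS]arc'; ring.
have -> : mink (f2 *: L + g2 *: e) t = 0 by rewrite !mink_linE lt et; ring.
have -> : mink (a *: (L + k *: N)) (f1 *: L + g1 *: e) = a * f1.
  by rewrite !mink_linE ll le nl ne; ring.
have -> : mink (a *: (L + k *: N)) t = 0 by rewrite !mink_linE lt nt; ring.
by apply/rowP => i; rewrite !mxE; field.
Qed.

(** * Minimality as an ordinary differential equation *)

(** The conclusion says that [f g'] is stationary at [u].  Multiplied by [g'], it
    becomes a multiple of the hypothesis [f f'' + f'^2 = 1] by means of
    [f' f'' + g' g'' = 0] and [f'^2 + g'^2 = 1]. *)
Lemma meridian_angular_momentum (R : realType) (I : set R) (f g : R -> R)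
    (u : R) :
  nondegenerate_interval I -> meridian_curve I f g -> I u ->
  f u * derive1 (derive1 f) u + derive1 f u ^+ 2 = 1 ->
  f u * derive1 (derive1 g) u + derive1 f u * derive1 g u = 0.
Proof.
move=> hI hm Iu; have [_ _ /(_ u Iu)[_ arc g10]] := hm.
move: arc g10 (arc_length_derive hI hm Iu).
move: (f u) (derive1 f u) (derive1 g u) (derive1 (derive1 f) u)
  (derive1 (derive1 g) u) => a f1 g1 f2 g2 arc g10 arc' ode.
apply: (mulfI g10); rewrite mulr0.
have -> : g1 * (a * g2 + f1 * g1) = a * (g1 * g2) + f1 * g1 ^+ 2 by ring.
have -> : g1 * g2 = - (f1 * f2) by lra.
have -> : g1 ^+ 2 = 1 - f1 ^+ 2 by lra.
by rewrite -[1]ode; ring.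
Qed.

(** Pairing [H = 0] with the orthonormal vectors [l] and [n] yields the two
    conditions.  Conversely they also kill the [e1] component of [H], by
    [meridian_angular_momentum]. *)
Lemma meridian_minimalP (R : realType) (I J : set R) (f g : R -> R)
    (l n : R -> 'rV[R]_4) :
  nondegenerate_interval I -> nondegenerate_interval J ->
  meridian_curve I f g -> spherical_timelike_curve J l ->
  spherical_unit_normal J l n ->
  minimal_on (meridian_surface f g l) I J <->
  (forall v, J v -> spherical_curvature l n v = 0) /\
  (forall u, I u -> f u * derive1 (derive1 f) u + derive1 f u ^+ 2 = 1).
Proof.
move=> hI hJ hm hl hn; have [fI gI fg] := hm.
have H0 u v := @meridian_mean_curvature R I J f g l n u v 0 hI hJ hm hl hn.
split=> [M|[k0 ff] u v Iu Jv]; last first.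
  apply/H0 => //; have [f0 _ _] := fg u Iu.
  have := meridian_angular_momentum hI hm Iu (ff u Iu); have := ff u Iu.
  rewrite (k0 v Jv) mul0r scale0r subr0; move: f0.
  move: (f u) (derive1 f u) (derive1 g u) (derive1 (derive1 f) u)
    (derive1 (derive1 g) u) => a f1 g1 f2 g2 a_gt0 ode fg0.
  have a0 : a != 0 by rewrite gt_eqF.
  have -> : f2 - (1 - f1 ^+ 2) / a = 0 by rewrite -ode; field.
  have -> : g2 + f1 * g1 / a = (a * g2 + f1 * g1) / a by field.
  by rewrite fg0 mul0r !scale0r addr0 scaler0.
have E u v : I u -> J v -> spherical_curvature l n v = 0 /\
    f u * derive1 (derive1 f) u + derive1 f u ^+ 2 = 1.
  move=> Iu Jv; have /H0 := M u v Iu Jv => /(_ Iu Jv).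
  have [f_gt0 _ _] := fg u Iu.
  have [le _ _ _] := spherical_frame hJ hl hn Jv.
  have [[_ ll] _] := hl.2 v Jv.
  have [ns nn nl _] := hn.2 v Jv; move: f_gt0.
  have ne := mink_span234 ns.
  have el : mink e1 (l v) = 0 by rewrite minkC.
  have en : mink e1 (n v) = 0 by rewrite minkC.
  have ln : mink (l v) (n v) = 0 by rewrite minkC.
  set B := (X in _ + X *: e1); move: B => B.
  move: (spherical_curvature l n v) (f u) (derive1 f u) (derive1 (derive1 f) u)
    => k a f1 f2 a_gt0 /eqP.
  rewrite eq_sym scaler_eq0 invr_eq0 pnatr_eq0 /= => /eqP HE.
  have a0 : a != 0 by rewrite gt_eqF.
  have K0 : k / a = 0.
    have := congr1 (fun w => mink w (n v)) HE.
    by rewrite /= [RHS]minkC mink0r !mink_linE ln en nn; lra.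
  have A0 : f2 - (1 - f1 ^+ 2) / a = 0.
    have := congr1 (fun w => mink w (l v)) HE.
    by rewrite /= [RHS]minkC mink0r !mink_linE ll el nl; lra.
  split; first by rewrite -[k](divfK a0) K0 mul0r.
  by apply/eqP; rewrite -subr_eq0 -[X in _ == X](mulr0 a) -A0; apply/eqP; field.
have [[_ [u0 [_ [Iu0 _ _]]]] [_ [v0 [_ [Jv0 _ _]]]]] := (hI, hJ).
by split=> [v Jv|u Iu]; [case: (E u0 v Iu0 Jv)|case: (E u v0 Iu Jv0)].
Qed.

(** The left-hand side of the equation is [(f f')'], and [f f'] is half of
    [(f^2)']: the constants [a] and [b] come from two integrations. *)
Lemma meridian_ode_square (R : realType) (I : set R) (f : R -> R) :
  nondegenerate_interval I -> smooth_on I f ->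
  (forall u, I u -> f u * derive1 (derive1 f) u + derive1 f u ^+ 2 = 1) <->
  (exists a b, forall u, I u ->
    f u * derive1 f u = u + a /\ f u ^+ 2 = u ^+ 2 + 2 * a * u + b).
Proof.
move=> hI fI; split=> [ode|[a [b ab]] u Iu].
  have [Iint [p [_ [Ip _ _]]]] := hI.
  have ff' u : I u -> f u * derive1 f u = u + (f p * derive1 f p - p).
    move=> Iu; suff : (f * derive1 f - id) u = (f * derive1 f - id) p.
      by rewrite !fctE => /eqP; rewrite subr_eq => /eqP ->; ring.
    apply: (is_derive0_cst_on Iint _ Iu Ip) => s Is.
    have [_ df ddf] := smooth_onP fI Is.
    apply: is_derive_eq.
    by rewrite /GRing.scale /= -(ode s Is); ring.
  pose a := f p * derive1 f p - p.
  pose h : R -> R := f ^+ 2 - (id ^+ 2 + (2 * a) \*: id).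
  exists a, (h p) => u Iu; split; first exact: ff'.
  suff <- : h u = h p by rewrite /h !fctE /= /GRing.scale /=; ring.
  apply: (is_derive0_cst_on Iint _ Iu Ip) => s Is.
  have [_ df ddf] := smooth_onP fI Is.
  apply: is_derive_eq.
  rewrite /GRing.scale /= !expr1.
  have -> : 2 * f s * derive1 f s = 2 * (f s * derive1 f s) by ring.
  by rewrite ff'// -/a; ring.
have [_ df ddf] := smooth_onP fI Iu.
have E s : I s -> (f * derive1 f) s = (id + cst a) s by move=> /ab[].
have := derive_unique_on_interval hI Iu E (is_deriveM df ddf)
  (is_deriveD (is_derive_id u 1) (is_derive_cst a u 1)).
by rewrite /GRing.scale /= addr0 => <-; ring.
Qed.

Lemma is_derive_quadratic (R : realType) (a b u : R) :
  is_derive u 1 (fun s => s ^+ 2 + 2 * a * s + b) (2 * u + 2 * a).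
Proof.
rewrite (_ : (fun s => _) = id ^+ 2 + (2 * a) \*: id + cst b) //.
by apply: is_derive_eq; rewrite /GRing.scale /=; ring.
Qed.

(** Completing the square, the radicand is [(u + a)^2 + (b - a^2)], which exceeds
    [(u + a)^2]; its square root therefore exceeds [|u + a|]. *)
Lemma completed_square_gt0 (R : realType) (a b u : R) :
  0 < b - a ^+ 2 ->
  [/\ 0 < u ^+ 2 + 2 * a * u + b
    & 0 < u + a + Num.sqrt (u ^+ 2 + 2 * a * u + b)].
Proof.
move=> ba; have q0 : 0 < u ^+ 2 + 2 * a * u + b.
  by have := sqr_ge0 (u + a); nra.
split=> //; rewrite -ltrBlDl sub0r (le_lt_trans (ler_norm _))// normrN.
by rewrite -sqrtr_sqr ltr_sqrt//; lra.
Qed.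

(** The argument of the logarithm is positive everywhere, so the absolute value
    disappears, and the derivative of [u + a + r], with [r] the square root, is
    [(u + a + r) / r]. *)
Lemma is_derive_ln_add_sqrt (R : realType) (a b u : R) :
  0 < b - a ^+ 2 ->
  is_derive u 1 (fun s => ln `|s + a + Num.sqrt (s ^+ 2 + 2 * a * s + b)|)
    (Num.sqrt (u ^+ 2 + 2 * a * u + b))^-1.
Proof.
move=> ba.
pose q s := s ^+ 2 + 2 * a * s + b.
pose w : R -> R := id + cst a + (Num.sqrt \o q).
have wE s : w s = s + a + Num.sqrt (q s) by [].
rewrite (_ : (fun s => _) = @ln R \o w); last first.
  apply/funext => s; have [_ w0] := completed_square_gt0 s ba.
  by rewrite (gtr0_norm w0).
have [q0 w0] := completed_square_gt0 u ba.
have sq : is_derive (q u) 1 Num.sqrt (2 * Num.sqrt (q u))^-1.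
  exact: is_derive1_sqrt.
have lw : is_derive (w u) 1 (@ln R) (w u)^-1 by exact: is_derive1_ln.
have wu : is_derive u 1 w (1 + 0 + (2 * Num.sqrt (q u))^-1 * (2 * u + 2 * a)).
  apply: is_deriveD.
  exact: (is_derive1_comp sq (is_derive_quadratic a b u)).
have r0 : 0 < Num.sqrt (q u) by rewrite sqrtr_gt0.
have lwu := is_derive1_comp lw wu; apply: (is_derive_eq lwu).
rewrite wE; move: w0; rewrite -/(q u); move: (Num.sqrt (q u)) r0 => r r0 w0.
by field; rewrite !gt_eqF.
Qed.

Theorem theorem6p1 (R : realType) (I J : set R) (f g : R -> R)
    (l n : R -> 'rV[R]_4)
    (hI : nondegenerate_interval I) (hJ : nondegenerate_interval J)
    (hm : meridian_curve I f g)
    (hl : spherical_timelike_curve J l)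
    (hn : spherical_unit_normal J l n) :
  minimal_on (meridian_surface f g l) I J <->
  (forall v : R, J v -> spherical_curvature l n v = 0) /\
  (exists a b c : R, 0 < b - a ^+ 2 /\
    exists s1 s2 : bool, forall u : R, I u ->
      f u = (-1) ^+ s1 * Num.sqrt (u ^+ 2 + 2 * a * u + b) /\
      g u = (-1) ^+ s2 * Num.sqrt (b - a ^+ 2)
              * ln `|u + a + Num.sqrt (u ^+ 2 + 2 * a * u + b)| + c).
Proof.
rewrite (meridian_minimalP hI hJ hm hl hn).
have [fI gI fg] := hm; have [Iint [p [_ [Ip _ _]]]] := hI.
split=> -[k0 F]; split=> //; last first.
  have {F} [a [b [c [ba [s1 [s2 F]]]]]] := F.
  have sq u : I u -> f u ^+ 2 = u ^+ 2 + 2 * a * u + b.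
    move=> /F[-> _]; rewrite exprMn sqrr_sign mul1r sqr_sqrtr//.
    by have [/ltW] := completed_square_gt0 u ba.
  apply/(meridian_ode_square hI fI); exists a, b => u Iu; split; last exact: sq.
  have [_ df _] := smooth_onP fI Iu.
  have E s : I s -> (f ^+ 2) s = s ^+ 2 + 2 * a * s + b by exact: sq.
  have := derive_unique_on_interval hI Iu E (is_deriveX 2 df)
    (is_derive_quadratic a b u).
  by rewrite /GRing.scale /= expr1; move: (derive1 f u) => f1; lra.
have ode := F; have [a [b ab]] := (meridian_ode_square hI fI).1 F.
have fg' : exists kappa, forall u, I u -> f u * derive1 g u = kappa.
  exists (f p * derive1 g p) => u Iu.
  apply: (is_derive0_cst_on (h := f * derive1 g) Iint _ Iu Ip) => s Is.
  have [_ df _] := smooth_onP fI Is; have [_ _ ddg] := smooth_onP gI Is.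
  apply: is_derive_eq; rewrite /GRing.scale /=.
  by rewrite -(meridian_angular_momentum hI hm Is (ode s Is)); ring.
have {fg'} [kappa fg'] := fg'.
(* [kappa^2 = f^2 (1 - f'^2) = f^2 - (f f')^2]. *)
have kappa2 : kappa ^+ 2 = b - a ^+ 2.
  have [ff' f2] := ab p Ip; have [_ arc _] := fg p Ip.
  rewrite -(fg' p Ip) exprMn.
  have -> : derive1 g p ^+ 2 = 1 - derive1 f p ^+ 2 by rewrite -arc; ring.
  by rewrite mulrBr mulr1 -exprMn ff' f2; ring.
have ba : 0 < b - a ^+ 2.
  have [f0 _ g10] := fg p Ip.
  by rewrite -kappa2 exprn_even_gt0//= -(fg' p Ip) mulf_neq0// gt_eqF.
have kappaE : kappa = (-1) ^+ (kappa < 0)%R * Num.sqrt (b - a ^+ 2).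
  by rewrite -kappa2 sqrtr_sqr -numEsign.
have fE u : I u -> f u = Num.sqrt (u ^+ 2 + 2 * a * u + b).
  move=> Iu; have [_ <-] := ab u Iu; have [f0 _ _] := fg u Iu.
  by rewrite sqrtr_sqr gtr0_norm.
pose L u := ln `|u + a + Num.sqrt (u ^+ 2 + 2 * a * u + b)|.
pose h : R -> R := g - kappa \*: L.
exists a, b, (h p); split=> //; exists false, (kappa < 0)%R => u Iu.
split; first by rewrite expr0 mul1r fE.
rewrite -kappaE -/(L u).
suff <- : h u = h p by rewrite /h !fctE /= /GRing.scale /=; ring.
apply: (is_derive0_cst_on Iint _ Iu Ip) => s Is.
have [_ dg _] := smooth_onP gI Is.
have dL := is_derive_ln_add_sqrt s ba.
apply: is_derive_eq; rewrite /GRing.scale /= -(fE s Is) -(fg' s Is).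
have [f0 _ _] := fg s Is.
move: f0; move: (f s) (derive1 g s) => y g1 y0.
by field; rewrite gt_eqF.
Qed.
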